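(* For a countable group $G$, the following are equivalent: (1) $G$ has no finitely generated subgroup of exponential growth; (2) there exists a moderate $\ell^1$-function on $G$, where $G$ is regarded as a $G$-set via left translation; (3) for every countable $G$-set $X$, there exists a moderate $\ell^1$-function on $X$.
   Context: A $G$-set is a set with an action of $G$. For a function $f\colon X\to\mathbb{R}$ on a set $X$, $\lim_{x\to\infty}f(x)=l$ means that $f(x)$ tends to $l$ as $x$ escapes from finite subsets of $X$: for every $\varepsilon>0$ there is a finite set $K\subset X$ such that $|f(x)-l|<\varepsilon$ for all $x\in X\setminus K$. A moderate $\ell^1$-function on a $G$-set $X$ is a function $\nu\in\ell^1(X)$ such that $\nu(x)>0$ for every $x\in X$ and, for every $g\in G$, $\lim_{x\to\infty}\nu(gx)/\nu(x)=1$. A finitely generated group $H$ with finite symmetric generating set $S$ containing the identity has exponential growth if $\lim_{n\to\infty}|S^n|^{1/n}>1$, where $S^n=\{s_1\cdots s_n: s_j\in S\}$ (this does not depend on $S$); otherwise it has subexponential growth. *)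

(* Defs.v *)
From HB Require Import structures.
From mathcomp Require Import all_boot all_order all_algebra finmap.
From mathcomp Require Import all_classical all_reals all_analysis.
Set Implicit Arguments.
Unset Strict Implicit.
Unset Printing Implicit Defensive.
Import Order.TTheory GRing.Theory Num.Theory.
Import numFieldNormedType.Exports.
Local Open Scope classical_set_scope.
Local Open Scope ring_scope.

(* The library's [action] is restricted to finite groups.  A [choiceType]
   carrier is no restriction: classically every type has that structure. *)
Record gset (G : groupType) := Gset {
  gset_sort :> choiceType;
  gact : G -> gset_sort -> gset_sort;
  gact1 : forall x, gact 1%g x = x;
  gactM : forall g h x, gact (g * h)%g x = gact g (gact h x) }.

Arguments gact {G _} _ _.

Definition left_translation (G : groupType) : gset G :=
  @Gset G G (fun g x => (g * x)%g) (@mul1g G) (fun g h x => esym (mulgA g h x)).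

(* Convergence along [frechet_filter], the filter of cofinite sets, is the
   limit as x escapes from finite subsets; on a finite X it always holds. *)
Definition moderate_l1 (R : realType) (G : groupType) (X : gset G)
    (nu : X -> R) : Prop :=
  [/\ summable [set: X] (fun x => (nu x)%:E),
      forall x, 0 < nu x &
      forall g : G,
        nu (gact g x) / nu x @[x --> (@frechet_filter X : set_system X)]
          --> (1 : R)].

Section Growth.
Variables (R : realType) (G : groupType).
Implicit Types H S : set G.

Definition subgroup H : Prop := group_closed (mem H).

Definition generates S H : Prop := smallest subgroup S = H.

Definition finitely_generated H : Prop :=
  exists2 S, finite_set S & generates S H.

Definition set_power S (n : nat) : set G :=
  [set x | exists2 s : 'I_n -> G,
     forall i, S (s i) & x = (\prod_(i < n) s i)%g].

Definition symmetric_generating_set S H : Prop :=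
  [/\ finite_set S, S 1%g, forall s, S s -> S s^-1%g & generates S H].

(* The n = 0 term is 1, since 0^-1 = 0; it does not affect the limit. *)
Definition exponential_growth H : Prop :=
  exists2 S, symmetric_generating_set S H &
    exists2 l : R,
      (#|` fset_set (set_power S n)|%:R : R) `^ n%:R^-1 @[n --> \oo] --> l &
      1 < l.

End Growth.

(* Main.v *)
Require Import Defs.
From mathcomp Require Import all_boot all_order all_algebra finmap.
From mathcomp Require Import all_classical all_reals all_analysis.
From mathcomp Require Import ring lra.
Set Implicit Arguments.
Unset Strict Implicit.
Unset Printing Implicit Defensive.
Import Order.TTheory GRing.Theory Num.Theory.
Import numFieldNormedType.Exports.
Local Open Scope classical_set_scope.
Local Open Scope ring_scope.

(** Condition (3) applied to left translation gives (2), so it is enough to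
    show that (2) implies (1) and that (1) implies (3).

    (2) implies (1).  Let [nu] be moderate on [G], let [S] be finite and let
    [lam > 1].  Left multiplication by an element of [S] divides [nu] by at
    most [lam] outside a finite set, whence [nu x >= c * lam ^- n] for [x] in
    [S^n], with [c > 0] independent of [n] ([moderate_lower_bound]).  If
    [|S^n|] grew like [l ^ n] with [l > lam], the sum of [nu] over [S^n] would
    be unbounded ([moderate_not_exponential]).

    (1) implies (3).  By Fekete's lemma ([fekete]) the sequence [|S^n|^(1/n)]
    converges to its infimum, so that (1) yields [|S^n| <= C * mu ^ n] for
    every [mu > 1] and every finite symmetric [S] containing [1]
    ([subexponential_bound]).  Exhaust [G] by finite symmetric sets [S_m], and
    [X] by finite sets [F_m]; let [q_m] in [(0, 1)] increase strictly to [1],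
    and put [B_m(k) = S_m^k F_m].  With weights [w_m > 0] small enough, the
    function

      [nu x = sup { w_m * q_m ^ k | x in B_m(k) }]

    is summable, since the sum over [m] and [k] of [w_m * q_m ^ k * |B_m(k)|]
    is finite.  It is moderate: let [g] be in [S_N], and let [x] be in
    [B_m(k)], so that [w_m * q_m ^ k] is one of the values defining [nu x].  If
    [m >= N], then [g x] is in [B_m(k + 1)] and only a factor [q_m >= q_N] is
    lost.  If [m < N], then [x] is also in [B_N(k)], so [g x] is in
    [B_N(k + 1)]; as [q_m < q_N], the value [w_N * q_N ^ (k + 1)] exceeds
    [w_m * q_m ^ k] as soon as [k] is large, which excludes only finitely many
    [x].  Hence [nu (g x) >= q_N * nu x] outside a finite set
    ([ball_sup_act]); the same bound for [g^-1] gives the limit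
    ([cvg_ball_sup_act]). *)

(** * Powers of a finite set *)

Section FsetCard.
Variables (T U V : choiceType).

Lemma card_fset_set_image2 (f : T -> U -> V) (A : set T) (B : set U) :
  finite_set A -> finite_set B ->
  (#|` fset_set [set f x y | x in A & y in B]|
     <= #|` fset_set A| * #|` fset_set B|)%N.
Proof.
move=> finA finB.
have finAB : finite_set [set f x y | x in A & y in B] by exact: finite_image2.
pose s := [seq f x y | x <- fset_set A, y <- fset_set B].
have -> : (#|` fset_set A| * #|` fset_set B|)%N = size s by rewrite size_allpairs.
apply: uniq_leq_size => [|z]; first exact: fset_uniq.
rewrite in_fset_set// inE => -[x Ax [y By <-]].
by apply: allpairs_f; rewrite in_fset_set// inE.
Qed.

End FsetCard.

Section SetPower.
Variable G : groupType.
Implicit Types S T : set G.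

Lemma set_power0 S : set_power S 0 = [set 1%g].
Proof.
apply/seteqP; split=> [x [s _ ->]|x ->]; first by rewrite /= big_ord0.
by exists (fun=> 1%g); [case|rewrite big_ord0].
Qed.

Lemma set_power1 S : set_power S 1 = S.
Proof.
apply/seteqP; split=> [x [s Ss ->]|x Sx].
  by rewrite big_ord_recl big_ord0 mulg1.
by exists (fun=> x) => //; rewrite big_ord_recl big_ord0 mulg1.
Qed.

Lemma set_powerD S m n :
  set_power S (m + n) =
  [set (x * y)%g | x in set_power S m & y in set_power S n].
Proof.
apply/seteqP; split=> [_ [s Ss ->]|_ [_ [s Ss ->] [_ [t St ->] <-]]].
  rewrite big_split_ord/=.
  exists (\prod_(i < m) s (lshift n i))%g.
    by exists (fun i => s (lshift n i)).
  exists (\prod_(i < n) s (rshift m i))%g => //.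
  by exists (fun i => s (rshift m i)).
exists (fun i => match fintype.split i with inl j => s j | inr j => t j end).
  by move=> i; case: (fintype.split i) => j.
rewrite big_split_ord; congr (_ * _)%g; apply: eq_bigr => i _.
  by rewrite (unsplitK (inl _ i)).
by rewrite (unsplitK (inr _ i)).
Qed.

Lemma finite_set_power S n : finite_set S -> finite_set (set_power S n).
Proof.
move=> finS; elim: n => [|n IHn]; first by rewrite set_power0.
by rewrite -addn1 set_powerD set_power1; apply: finite_image2.
Qed.

Lemma card_set_powerD S m n : finite_set S ->
  (#|` fset_set (set_power S (m + n))|
     <= #|` fset_set (set_power S m)| * #|` fset_set (set_power S n)|)%N.
Proof.
move=> finS; rewrite set_powerD.
by apply: card_fset_set_image2; apply: finite_set_power.
Qed.

Lemma sub_set_power S T n : S `<=` T -> set_power S n `<=` set_power T n.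
Proof. by move=> ST _ [s Ss ->]; exists s => // i; apply: ST. Qed.

Lemma set_power_one S n : S 1%g -> set_power S n 1%g.
Proof. by move=> S1; exists (fun=> 1%g) => //; rewrite big1. Qed.

Lemma card_set_power_gt0 S n : finite_set S -> S 1%g ->
  (0 < #|` fset_set (set_power S n)|)%N.
Proof.
move=> finS S1; rewrite cardfs_gt0; apply/fset0Pn; exists 1%g.
by rewrite in_fset_set ?inE; [exact: set_power_one|exact: finite_set_power].
Qed.

End SetPower.

(** * Submultiplicative sequences *)

Section Roots.
Variable R : realType.
Implicit Types a mu C : R.

Lemma powR_invn_le a mu n : 0 <= a -> 0 <= mu -> (0 < n)%N ->
  (a `^ n%:R^-1 <= mu) = (a <= mu ^+ n).
Proof.
move=> a_ge0 mu_ge0 n_gt0; rewrite -powR_mulrn//.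
have n_neq0 : n%:R != 0 :> R by rewrite pnatr_eq0 -lt0n.
apply/idP/idP => h.
  have -> : a = (a `^ n%:R^-1) `^ n%:R by rewrite -powRrM mulVf// powRr1.
  by rewrite ge0_ler_powR ?nnegrE ?powR_ge0.
have -> : mu = (mu `^ n%:R) `^ n%:R^-1 by rewrite -powRrM mulfV// powRr1.
by rewrite ge0_ler_powR ?nnegrE ?powR_ge0 ?invr_ge0.
Qed.

Lemma cvg_root_const C : 0 < C -> C `^ n%:R^-1 @[n --> \oo] --> (1 : R).
Proof.
move=> C_gt0.
have -> : (fun n : nat => C `^ n%:R^-1) = (fun n => expR (n%:R^-1 * ln C)).
  by apply/funext => n; rewrite /powR gt_eqF.
suff n0 : n%:R^-1 * ln C @[n --> \oo] --> (0 : R).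
  have := cvg_comp _ _ n0 (@continuous_expR R 0).
  by rewrite expR0.
rewrite -[X in _ --> X](mul0r (ln C)); apply: cvgMl.
apply/cvgrPdist_lt => e e_gt0; near=> n.
have en : e^-1 < n%:R by near: n; exact: nbhs_infty_gtr.
rewrite sub0r normrN ger0_norm ?invr_ge0//.
by rewrite -[ltRHS]invrK ltf_pV2 ?posrE ?invr_gt0// (lt_trans _ en) ?invr_gt0.
Unshelve. all: by end_near. Qed.

End Roots.

Section Submultiplicative.
Variables (R : realType) (u : nat -> R).
Hypothesis u_ge1 : forall n, 1 <= u n.
Hypothesis u_submul : forall m n, u (m + n) <= u m * u n.

Let u_gt0 n : 0 < u n. Proof. exact: lt_le_trans (u_ge1 n). Qed.

(** A geometric bound at a single index [j] propagates to all indices, by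
    Euclidean division by [j]. *)
Lemma submul_le_geometric (mu : R) (j : nat) :
  (0 < j)%N -> 1 <= mu -> u j <= mu ^+ j ->
  exists2 C : R, 0 < C & forall n, u n <= C * mu ^+ n.
Proof.
move=> j_gt0 mu_ge1 ujmu.
have mu_ge0 : 0 <= mu by apply: le_trans mu_ge1.
exists (\sum_(r < j) u r).
  case: j j_gt0 {ujmu} => // j _; rewrite big_ord_recl ltr_pwDl//.
  by apply: sumr_ge0 => i _; exact: ltW.
have umul q r : u (q * j + r) <= mu ^+ (q * j) * u r.
  elim: q => [|q IHq]; first by rewrite mul0n add0n expr0 mul1r.
  rewrite mulSn -addnA (le_trans (u_submul _ _))// exprD -mulrA.
  by rewrite ler_pM// ltW.
move=> n; rewrite {1}(divn_eq n j) (le_trans (umul _ _))// mulrC.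
have rj : (n %% j < j)%N by rewrite ltn_pmod.
apply: ler_pM; rewrite ?exprn_ge0 ?(ltW (u_gt0 _))//.
  rewrite (bigD1 (Ordinal rj))//= lerDl.
  by apply: sumr_ge0 => i _; exact: ltW.
by rewrite ler_weXn2l// {2}(divn_eq n j) leq_addr.
Qed.

(** Fekete's lemma, in multiplicative form. *)
Lemma fekete : u n `^ n%:R^-1 @[n --> \oo] -->
  inf [set u n `^ n%:R^-1 | n in [set n | (0 < n)%N]].
Proof.
set E := [set _ | _ in _].
have lbE : lbound E 1.
  move=> _ [n _ <-]; have := ler_powR (u_ge1 n).
  by move=> /(_ 0 n%:R^-1); rewrite powRr0 invr_ge0; exact.
have E0 : E !=set0 by exists (u 1%N `^ 1%:R^-1); exists 1%N.
have hasE : has_inf E by split=> //; exists 1.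
have l_ge1 : 1 <= inf E by exact: lb_le_inf.
apply/cvgrPdist_le => e e_gt0.
have e2_gt0 : 0 < e / 2 by rewrite divr_gt0.
have [_ [j j_gt0 <-] uj] := inf_adherent e2_gt0 hasE.
set mu := inf E + e / 2 in uj.
have mu_ge1 : 1 <= mu by rewrite ler_wpDr// ltW.
have mu_gt0 : 0 < mu by rewrite (lt_le_trans _ mu_ge1).
have [C C_gt0 uC] : exists2 C : R, 0 < C & forall n, u n <= C * mu ^+ n.
  apply: (@submul_le_geometric mu j) => //.
  by rewrite -powR_invn_le ?(ltW (u_gt0 _))// ltW.
have : C `^ n%:R^-1 * mu @[n --> \oo] --> 1 * mu.
  by apply: cvgMl; exact: cvg_root_const.
rewrite mul1r => /cvgrPdist_lt/(_ _ e2_gt0) Cmu.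
near=> n.
have n_gt0 : (0 < n)%N by near: n; exact: nbhs_infty_gt.
have lun : inf E <= u n `^ n%:R^-1 by apply: ge_inf; [exists 1|exists n].
rewrite distrC ger0_norm ?subr_ge0//.
have rC : u n `^ n%:R^-1 <= C `^ n%:R^-1 * mu.
  have mu_ge0 := ltW mu_gt0; have C_ge0 := ltW C_gt0.
  have n_neq0 : n%:R != 0 :> R by rewrite pnatr_eq0 -lt0n.
  rewrite powR_invn_le ?mulr_ge0 ?powR_ge0 ?(ltW (u_gt0 _))// exprMn.
  by rewrite -(powR_mulrn _ (powR_ge0 _ _)) -powRrM mulVf// powRr1.
have : `|mu - C `^ n%:R^-1 * mu| < e / 2 by near: n; exact: Cmu.
rewrite /mu ltr_distlC => /andP[_]; move: rC; rewrite /mu; lra.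
Unshelve. all: by end_near. Qed.

End Submultiplicative.

(** * Subexponential growth *)

Section Growth.
Variables (R : realType) (G : groupType).
Implicit Types S H : set G.

Lemma subgroup_smallest S : subgroup (smallest (@subgroup G) S).
Proof.
split=> [|x y].
  by apply/mem_set => A [[A1 _] _]; exact: set_mem.
move=> /set_mem Sx /set_mem Sy; apply/mem_set => A [sA SA]; apply: set_mem.
have [_ divA] := sA.
by apply: divA; apply/mem_set; [exact: Sx|exact: Sy].
Qed.

(** Either [|S^j| <= mu ^ j] for some [j > 0], and this bound propagates, or
    the limit of [|S^n|^(1/n)] is at least [mu > 1]. *)
Lemma subexponential_bound S H : symmetric_generating_set S H ->
  ~ exponential_growth R H -> forall mu : R, 1 < mu ->
  exists2 C : R, 0 < C &
    forall n, #|` fset_set (set_power S n)|%:R <= C * mu ^+ n.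
Proof.
move=> symS; have [finS S1 _ _] := symS => nexp mu mu_gt1.
pose u n : R := #|` fset_set (set_power S n)|%:R.
have u_ge1 n : 1 <= u n by rewrite ler1n card_set_power_gt0.
have u_submul m n : u (m + n)%N <= u m * u n.
  by rewrite -natrM ler_nat card_set_powerD.
have [[j [j_gt0 uj]]|nuj] := pselect (exists j, (0 < j)%N /\ u j <= mu ^+ j).
  exact: (submul_le_geometric u_ge1 u_submul j_gt0 (ltW mu_gt1) uj).
case: nexp; exists S => //.
exists (inf [set u n `^ n%:R^-1 | n in [set n | (0 < n)%N]]).
  exact: fekete.
apply: (lt_le_trans mu_gt1); apply: lb_le_inf => [|_ [n n_gt0 <-]].
  by exists (u 1%N `^ 1%:R^-1); exists 1%N.
have mu_ge0 : 0 <= mu by lra.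
apply/ltW; rewrite ltNge powR_invn_le//.
by apply/negP => un; apply: nuj; exists n.
Qed.

Lemma geometric_sum_bound (u : nat -> R) :
  (forall mu : R, 1 < mu ->
    exists2 C : R, 0 < C & forall n, u n <= C * mu ^+ n) ->
  forall q : R, 0 < q < 1 ->
  exists2 D : R, 0 < D & forall K, \sum_(k < K) q ^+ k * u k <= D.
Proof.
move=> ub q /andP[q_gt0 q_lt1].
(* The rate (1 + q^-1) / 2 exceeds 1, and multiplied by q it stays below 1. *)
have [|C C_gt0 uC] := ub ((1 + q^-1) / 2).
  have : 1 < q^-1 by rewrite invf_gt1.
  lra.
pose r := (q + 1) / 2.
have r01 : 0 < r < 1 by rewrite /r; apply/andP; split; lra.
have qmu k : q ^+ k * ((1 + q^-1) / 2) ^+ k = r ^+ k.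
  by rewrite -exprMn; congr (_ ^+ _); rewrite /r; field; rewrite gt_eqF.
exists (C / (1 - r)) => [|K]; first by rewrite divr_gt0//; lra.
apply: (@le_trans _ _ (\sum_(k < K) C * r ^+ k)).
  apply: ler_sum => k _; rewrite -qmu mulrCA ler_wpM2l ?exprn_ge0// ltW//.
rewrite -mulr_sumr ler_wpM2l ?(ltW C_gt0)// -[leRHS]mul1r ler_pdivlMr; last lra.
have := subrX1 r K; have : 0 <= r ^+ K by rewrite exprn_ge0//; lra.
rewrite mulrC; lra.
Qed.

End Growth.

(** * A moderate function from families of balls *)

Section ModerateOfBalls.
Variables (R : realType) (G : groupType) (X : gset G).
(* [B m k] plays the role of the ball of radius [k] at scale [m]. *)
Variable B : nat -> nat -> set X.
Hypothesis finB : forall m k, finite_set (B m k).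
Hypothesis B_mono : forall m n k, (m <= n)%N -> B m k `<=` B n k.
Hypothesis B_cover : forall x, exists m k, B m k x.
Hypothesis B_act : forall g, exists N, forall m k x,
  (N <= m)%N -> B m k x -> B m k.+1 (gact g x).
Hypothesis B_growth : forall m (q : R), 0 < q < 1 ->
  exists2 D : R, 0 < D &
    forall K, \sum_(k < K) q ^+ k * #|` fset_set (B m k)|%:R <= D.

(* Any sequence in (0, 1) increasing strictly to 1 would do. *)
Let q m : R := 1 - m.+2%:R^-1.

Let q_gt0 m : 0 < q m.
Proof. by rewrite subr_gt0 invf_lt1 ?ltr1n ?ltr0n. Qed.

Let q_lt1 m : q m < 1.
Proof. by rewrite /q gtrBl invr_gt0 ltr0n. Qed.

Let q_ge0 m : 0 <= q m. Proof. exact: ltW. Qed.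

Let q_lt m n : (m < n)%N -> q m < q n.
Proof.
by move=> mn; rewrite /q ltrD2l ltrN2 ltf_pV2 ?posrE ?ltr0n// ltr_nat ltnS.
Qed.

Let q_le m n : (m <= n)%N -> q m <= q n.
Proof. by rewrite leq_eqVlt => /predU1P[->//|/q_lt/ltW]. Qed.

(** Weights that make the total mass of the balls at scale [m] at most
    [2 ^- m.+1]. *)
Lemma ball_weights : exists2 w : nat -> R, (forall m, 0 < w m <= 1) &
  forall m K, \sum_(k < K) w m * q m ^+ k * #|` fset_set (B m k)|%:R
                <= 2^-1 ^+ m.+1.
Proof.
have /choice[D Dgrowth] : forall m, exists D : R, 0 < D /\
    forall K, \sum_(k < K) q m ^+ k * #|` fset_set (B m k)|%:R <= D.
  move=> m; have [|D D_gt0 HD] := @B_growth m (q m); last by exists D.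
  by rewrite q_gt0 q_lt1.
have D_gt0 m : 0 < D m by case: (Dgrowth m).
exists (fun m => 2^-1 ^+ m.+1 / (1 + D m)) => [m|m K].
  have D1 : 0 < 1 + D m by rewrite addr_gt0.
  rewrite divr_gt0 ?exprn_gt0//= ler_pdivrMr// mul1r.
  have : 2^-1 ^+ m.+1 <= (1 : R) by rewrite exprn_ile1//; lra.
  by have := D_gt0 m; lra.
under eq_bigr do rewrite -mulrA.
rewrite -mulr_sumr -mulrA ler_piMr ?exprn_ge0//.
rewrite mulrC ler_pdivrMr ?addr_gt0// mul1r.
by have [_ /(_ K)] := Dgrowth m; lra.
Qed.

Section Weights.
Variable w : nat -> R.
Hypothesis w01 : forall m, 0 < w m <= 1.
Hypothesis w_sum : forall m K,
  \sum_(k < K) w m * q m ^+ k * #|` fset_set (B m k)|%:R <= 2^-1 ^+ m.+1.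

Let w_gt0 m : 0 < w m. Proof. by case/andP: (w01 m). Qed.

Let values x : set R := [set r | exists m k, B m k x /\ r = w m * q m ^+ k].

(** The supremum of the weights [w m * q m ^+ k] of the balls [B m k]
    containing [x]; these weights are bounded by 1. *)
Definition ball_sup (x : X) : R := sup (values x).

Let has_sup_values x : has_sup (values x).
Proof.
split; first by have [m [k Bx]] := B_cover x; exists (w m * q m ^+ k), m, k.
exists 1 => _ [m [k [_ ->]]]; have /andP[_ w1] := w01 m.
by rewrite mulr_ile1 ?exprn_ge0 ?exprn_ile1// ltW.
Qed.

Let ball_sup_ge m k x : B m k x -> w m * q m ^+ k <= ball_sup x.
Proof.
by move=> Bx; apply: ub_le_sup; [case: (has_sup_values x)|exists m, k].
Qed.

Lemma ball_sup_gt0 x : 0 < ball_sup x.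
Proof.
have [m [k Bx]] := B_cover x; apply: lt_le_trans (ball_sup_ge Bx).
by rewrite mulr_gt0 ?exprn_gt0.
Qed.

Let ball_sup_adherent x : exists mk : nat * nat,
  B mk.1 mk.2 x /\ ball_sup x <= 2 * (w mk.1 * q mk.1 ^+ mk.2).
Proof.
have nu2 : 0 < ball_sup x / 2 by rewrite divr_gt0 ?ball_sup_gt0.
have [_ [m [k [Bx ->]]]] := sup_adherent nu2 (has_sup_values x).
by rewrite -/(ball_sup x) => lt; exists (m, k); split => //=; lra.
Qed.

(* Since q m < q n, scale m is dominated by scale n at all large radii, with
   one unit of radius to spare. *)
Let geometric_dominated m n : (m < n)%N ->
  exists K, forall k, (K <= k)%N -> w m * q m ^+ k <= w n * q n ^+ k.+1.
Proof.
move=> mn; pose r := q m / q n.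
have r_lt1 : `|r| < 1.
  by rewrite ger0_norm ?divr_ge0 // ltr_pdivrMr// mul1r q_lt.
have c_gt0 : 0 < w n * q n / w m by rewrite divr_gt0 ?mulr_gt0.
have /cvgrPdist_lt/(_ _ c_gt0)[K _ rK] := cvg_expr r_lt1.
exists K => k Kk; have /= := rK k Kk.
rewrite sub0r normrN ger0_norm ?exprn_ge0 ?divr_ge0//.
rewrite expr_div_n ltr_pdivrMr ?exprn_gt0// mulrAC ltr_pdivlMr// => /ltW.
by rewrite [q m ^+ k * _]mulrC exprS mulrA.
Qed.

Lemma ball_sup_act g n : exists2 F : set X, finite_set F &
  forall x, ~ F x -> q n * ball_sup x <= ball_sup (gact g x).
Proof.
have [N0 actN0] := B_act g; pose N := maxn N0 n.
have N0N : (N0 <= N)%N := leq_maxl _ _.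
have /choice[K HK] : forall m, exists K, (m < N)%N -> forall k, (K <= k)%N ->
    w m * q m ^+ k <= w N * q N ^+ k.+1.
  move=> m; have [mN|_] := ltnP m N; last by exists 0%N.
  by have [K HK] := geometric_dominated mN; exists K.
(* Discard the balls of scale m < N whose radius is too small for the
   comparison with scale N. *)
exists (\bigcup_(m in `I_N) \bigcup_(k in `I_(K m)) B m k).
  by apply: bigcup_finite => // m _; apply: bigcup_finite.
move=> x Fx; apply: (@le_trans _ _ (q N * ball_sup x)).
  by rewrite (ler_wpM2r (ltW (ball_sup_gt0 _)))//; exact/q_le/leq_maxr.
rewrite mulrC -ler_pdivlMr//; apply: ge_sup; first by case: (has_sup_values x).
move=> _ [m [k [Bx ->]]]; rewrite ler_pdivlMr//.
have a_ge0 : 0 <= w m * q m ^+ k by rewrite mulr_ge0 ?exprn_ge0 ?ltW.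
have [Nm|mN] := leqP N m.
  apply: le_trans (ball_sup_ge (actN0 m k x (leq_trans N0N Nm) Bx)).
  by rewrite exprSr mulrA ler_wpM2l ?q_le.
have Kk : (K m <= k)%N.
  by rewrite leqNgt; apply/negP => kK; apply: Fx; exists m => //; exists k.
apply: le_trans (ball_sup_ge (actN0 N k x N0N (B_mono (ltnW mN) Bx))).
by apply: le_trans (HK m mN k Kk); rewrite ler_piMr// ltW.
Qed.

Lemma cvg_ball_sup_act g :
  ball_sup (gact g x) / ball_sup x @[x --> (@frechet_filter X : set_system X)]
    --> (1 : R).
Proof.
move=> A /nbhs_ballP[e /= e_gt0 eA].
have [n qn] : exists n, (1 + e)^-1 < q n.
  have [n _ /(_ n (leqnn n)) /= Hn] := nbhs_infty_gtr ((1 + e) / e).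
  exists n; have e1 : 0 < 1 + e by lra.
  have en : n.+2%:R^-1 < e / (1 + e).
    rewrite -[ltRHS]invrK ltf_pV2 ?posrE ?invr_gt0 ?divr_gt0//.
    by rewrite invf_div (lt_trans Hn)// ltr_nat.
  have : (1 + e)^-1 = 1 - e / (1 + e) by field; rewrite gt_eqF.
  by rewrite /q => ->; rewrite ltrD2l ltrN2.
have [F1 finF1 HF1] := ball_sup_act g n.
have [F2 finF2 HF2] := ball_sup_act g^-1%g n.
apply: (@sub_finite_set _ _ (F1 `|` gact g^-1%g @` F2)); last first.
  by rewrite finite_setU; split=> //; exact: finite_image.
move=> x /= nAx; apply: contrapT => /not_orP[nF1 nF2]; apply: nAx; apply: eA.
have h1 := HF1 x nF1.
have h2 : q n * ball_sup (gact g x) <= ball_sup x.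
  have gK : gact g^-1%g (gact g x) = x by rewrite -gactM mulVg gact1.
  rewrite -{2}gK; apply: HF2 => F2x; apply: nF2; exists (gact g x) => //.
have x_gt0 := ball_sup_gt0 x.
rewrite /ball /= ltr_distlC; apply/andP; split.
  rewrite ltr_pdivlMr//; apply: lt_le_trans h1; rewrite ltr_pM2r//.
  apply: le_lt_trans qn; rewrite -[leRHS]mul1r ler_pdivlMr; last lra.
  by have := mulr_gt0 e_gt0 e_gt0; lra.
rewrite ltr_pdivrMr// -(ltr_pM2l (q_gt0 n)); apply: le_lt_trans h2 _.
rewrite mulrA -[ltLHS]mul1r ltr_pM2r// -ltr_pdivrMr ?mul1r//; lra.
Qed.

(** Each [ball_sup x] is at most twice the weight of some ball containing [x];
    the sum over [x] of these weights is at most the total mass of the balls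
    involved. *)
Lemma sum_ball_sup_le (s : seq X) : uniq s -> \sum_(x <- s) ball_sup x <= 2.
Proof.
move=> s_uniq; have /choice[p Hp] := ball_sup_adherent.
pose a m k := w m * q m ^+ k.
have a_ge0 m k : 0 <= a m k by rewrite mulr_ge0 ?exprn_ge0 ?ltW.
pose L := (maxn (\max_(x <- s) (p x).1) (\max_(x <- s) (p x).2)).+1.
have p1L x : x \in s -> ((p x).1 < L)%N.
  move=> xs; rewrite ltnS leq_max.
  by rewrite (@leq_bigmax_seq _ s xpredT (fun y => (p y).1) x).
have p2L x : x \in s -> ((p x).2 < L)%N.
  move=> xs; rewrite ltnS leq_max.
  by rewrite (@leq_bigmax_seq _ s xpredT (fun y => (p y).2) x) ?orbT.
pose f x := \sum_(m < L) \sum_(k < L) a m k * (x \in B m k)%:R.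
apply: (@le_trans _ _ (\sum_(x <- s) 2 * f x)).
  rewrite big_seq [leRHS]big_seq; apply: ler_sum => x xs.
  have [Bx /le_trans] := Hp x; apply; rewrite ler_wpM2l//.
  rewrite /f (bigD1 (Ordinal (p1L x xs)))//= (bigD1 (Ordinal (p2L x xs)))//=.
  rewrite mem_set// mulr1 -addrA lerDl addr_ge0//.
    by apply: sumr_ge0 => k _; rewrite mulr_ge0.
  by apply: sumr_ge0 => m _; apply: sumr_ge0 => k _; rewrite mulr_ge0.
rewrite -mulr_sumr -[leRHS]mulr1 ler_wpM2l// /f exchange_big/=.
apply: (@le_trans _ _ (\sum_(m < L) 2^-1 ^+ m.+1)).
  apply: ler_sum => m _; apply: le_trans (w_sum m L).
  rewrite exchange_big/=; apply: ler_sum => k _.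
  rewrite -mulr_sumr ler_wpM2l// -natr_sum ler_nat.
  rewrite (_ : (\sum_(_ <- _) _)%N = count [in B m k] s); last first.
    rewrite -sum1_count [RHS]big_mkcond.
    by apply: eq_bigr => x _ /=; case: (x \in _).
  rewrite -size_filter; apply: uniq_leq_size => [|x]; first exact: filter_uniq.
  by rewrite mem_filter in_fset_set// => /andP[].

have -> : \sum_(m < L) 2^-1 ^+ m.+1 = 1 - 2^-1 ^+ L :> R.
  elim: L {p1L p2L f} => [|L IHL]; first by rewrite big_ord0 expr0 subrr.
  by rewrite big_ord_recr/= IHL exprS; field.
by rewrite gerBl exprn_ge0.
Qed.

Lemma moderate_ball_sup : moderate_l1 ball_sup.
Proof.
split; [|exact: ball_sup_gt0|exact: cvg_ball_sup_act].
apply: (@le_lt_trans _ _ 2%:E); last exact: ltry.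
apply: ub_ereal_sup => _ [A [finA _] <-].
rewrite fsbig_finite// sumEFin lee_fin.
under eq_bigr do rewrite ger0_norm ?ltW ?ball_sup_gt0//.
by apply: sum_ball_sup_le; exact: fset_uniq.
Qed.

End Weights.

(** A moderate function exists as soon as [X] is exhausted by finite balls
    [B m k], nondecreasing in the scale [m], such that each [g] moves [B m k]
    into [B m k.+1] at all large scales, and such that at each scale the
    cardinals grow subexponentially with the radius [k]. *)
Lemma moderate_of_balls : exists nu : X -> R, moderate_l1 nu.
Proof.
have [w w01 w_sum] := ball_weights.
by exists (ball_sup w); exact: moderate_ball_sup.
Qed.

End ModerateOfBalls.

(** * Groups without exponential growth *)

Section ModerateOfSubexponential.
Variables (R : realType) (G : groupType).

Lemma finite_initial (T : Type) (f : T -> nat) (m : nat) :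
  injective f -> finite_set [set x | (f x <= m)%N].
Proof.
move=> f_inj; apply: (@sub_finite_set _ _ (f @^-1` `I_m.+1)) => //.
by apply: finite_preimage => // x y _ _; exact: f_inj.
Qed.

Lemma countable_inj (T : Type) : countable [set: T] ->
  exists f : T -> nat, injective f.
Proof.
by move=> /countable_injP[f f_inj]; exists f => x y; apply: f_inj; rewrite inE.
Qed.

(** The balls are [B m k = S_m^k F_m], for increasing exhaustions of [G] by
    finite symmetric sets [S_m] and of [X] by finite sets [F_m]. *)
Lemma no_exponential_growth_moderate (X : gset G) :
  countable [set: G] -> countable [set: X] ->
  ~ (exists H : set G,
      [/\ subgroup H, finitely_generated H & exponential_growth R H]) ->
  exists nu : X -> R, moderate_l1 nu.
Proof.
move=> /countable_inj[f f_inj] /countable_inj[h h_inj] nexp.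
pose S m : set G :=
  [set g | (f g <= m)%N] `|` [set g | (f g^-1%g <= m)%N] `|` [set 1%g].
pose F m : set X := [set x | (h x <= m)%N].
have finS m : finite_set (S m).
  rewrite !finite_setU; split; last exact: finite_set1.
  split; first exact: finite_initial.
  apply: (@finite_initial _ (fun g => f g^-1%g)) => x y /f_inj.
  exact: invg_inj.
have finF m : finite_set (F m) by exact: finite_initial.
have symS m :
    symmetric_generating_set (S m) (smallest (@subgroup G) (S m)).
  split=> //; first by right.
  move=> s [[/= s1|/= s1]| ->].
  - by left; right => /=; rewrite invgK.
  - by left; left.
  - by right; rewrite invg1.
have nexpS m : ~ exponential_growth R (smallest (@subgroup G) (S m)).
  move=> expS; apply: nexp; exists (smallest (@subgroup G) (S m)).
  by split=> //; [exact: subgroup_smallest|exists (S m)].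
have S_mono m n : (m <= n)%N -> S m `<=` S n.
  move=> mn g [[/= gm|/= gm]|->]; last by right.
    by left; left; exact: leq_trans mn.
  by left; right; exact: leq_trans mn.
pose B m k : set X := [set gact g x | g in set_power (S m) k & x in F m].
apply: (@moderate_of_balls R G X B).
- by move=> m k; apply: finite_image2; [exact: finite_set_power|exact: finF].
- move=> m n k mn _ [g Sg [x Fx <-]]; exists g.
    exact: sub_set_power (S_mono _ _ mn) _ Sg.
  by exists x => //; exact: leq_trans mn.
- move=> x; exists (h x), 0%N; exists 1%g; first by rewrite set_power0.
  by exists x; [exact: leqnn|rewrite gact1].
- move=> g; exists (f g) => m k _ gm [a Sa [x Fx <-]]; exists (g * a)%g.
    rewrite -add1n set_powerD set_power1; exists g; first by left; left.
    by exists a.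
  by exists x => //; rewrite gactM.
move=> m q q01.
pose u k : R := #|` fset_set (set_power (S m) k)|%:R.
have [|D D_gt0 HD] := @geometric_sum_bound R u _ q q01.
  exact: subexponential_bound (symS m) (nexpS m).
pose c : R := #|` fset_set (F m)|%:R.
have c_ge0 : 0 <= c by rewrite ler0n.
exists (D * (1 + c)) => [|K]; first by rewrite mulr_gt0// ltr_wpDr.
apply: (@le_trans _ _ ((\sum_(k < K) q ^+ k * u k) * c)); last first.
  have := ler_wpM2r c_ge0 (HD K); nra.
have q_ge0 : 0 <= q by case/andP: q01 => /ltW.
rewrite mulr_suml; apply: ler_sum => k _; rewrite -mulrA.
rewrite ler_wpM2l ?exprn_ge0// -natrM ler_nat.
by apply: card_fset_set_image2; [exact: finite_set_power|exact: finF].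
Qed.

End ModerateOfSubexponential.

(** * Growth of groups with a moderate summable function *)

Section SubexponentialOfModerate.
Variables (R : realType) (G : groupType).

Lemma summable_sum_bound (T : choiceType) (nu : T -> R) :
  summable [set: T] (fun x => (nu x)%:E) -> (forall x, 0 < nu x) ->
  exists M : R, forall A : {fset T}, \sum_(x <- A) nu x <= M.
Proof.
move=> sum_nu nu_gt0.
exists (fine (\esum_(x in [set: T]) `|(nu x)%:E|)%E) => A.
rewrite -lee_fin fineK; last by rewrite ge0_fin_numE ?esum_ge0.
apply: esum_ge; exists [set` A]; first by split.
rewrite fsbig_finite// set_fsetK sumEFin lee_fin ler_sum// => x _.
exact: ler_norm.
Qed.

Lemma seq_pos_lower_bound (T : eqType) (nu : T -> R) (s : seq T) :
  (forall x, 0 < nu x) -> exists2 c, 0 < c & forall x, x \in s -> c <= nu x.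
Proof.
move=> nu_gt0; elim: s => [|y s [c c_gt0 cs]]; first by exists 1.
exists (Num.min (nu y) c) => [|x]; first by rewrite lt_min nu_gt0.
by rewrite inE ge_min => /predU1P[->|/cs ->]; rewrite ?lexx ?orbT.
Qed.

(** A step [y -> s y] divides [nu] by more than [lam] only for [y] in a finite
    set; after such a step, [nu] is bounded below by its minimum over the
    finitely many possible endpoints. *)
Lemma moderate_lower_bound (nu : left_translation G -> R) (S : set G)
    (lam : R) :
  moderate_l1 nu -> finite_set S -> 1 < lam ->
  exists2 c, 0 < c &
    forall n x, set_power S n x -> c <= lam ^+ n * nu x.
Proof.
move=> [_ nu_gt0 nu_cvg] finS lam_gt1.
have lam_gt0 : 0 < lam by lra.
pose K s := [set x | lam * nu (s * x)%g < nu x].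
have finK s : finite_set (K s).
  have e_gt0 : 0 < 1 - lam^-1 by rewrite subr_gt0 invf_lt1.
  have : finite_set
      (~` [set x : G | ball (1 : R) (1 - lam^-1) (nu (s * x)%g / nu x)]).
    exact: nu_cvg s _ (nbhsx_ballx _ _ e_gt0).
  apply: sub_finite_set => x /= Kx; rewrite /ball /= ltr_distlC => /andP[+ _].
  rewrite opprB addrCA subrr addr0 ltr_pdivlMr// mulrC ltr_pdivrMr// mulrC.
  by move=> /(lt_trans Kx); rewrite ltxx.
pose A : set G :=
  [set (s * x)%g | s in S & x in \bigcup_(s in S) K s] `|` [set 1%g].
have finA : finite_set A.
  rewrite finite_setU; split; last exact: finite_set1.
  by apply: finite_image2 => //; apply: bigcup_finite.
have [c c_gt0 cA] := seq_pos_lower_bound (fset_set A) nu_gt0.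
have {}cA x : A x -> c <= nu x.
  by move=> Ax; apply: cA; rewrite in_fset_set// inE.
exists c => // n; elim: n => [|n IHn] x.
  by rewrite set_power0 => ->; rewrite mul1r; apply: cA; right.
rewrite -add1n set_powerD set_power1 => -[s Ss [y Sy <-]].
have [Ky|nKy] := pselect (K s y).
  apply: (@le_trans _ _ (nu (s * y)%g)).
    by apply: cA; left; exists s => //; exists y => //; exists s.
  by rewrite ler_peMl ?exprn_ege1// ltW.
apply: le_trans (IHn y Sy) _; rewrite add1n exprSr -mulrA ler_wpM2l//.
  by rewrite exprn_ge0 ?ltW.
by rewrite leNgt; apply/negP.
Qed.

(** If [S^n] has about [l^n] elements and [1 < lam < mu < l], then the sum of
    [nu] over [S^n] is at least a constant times [(mu / lam)^n]. *)
Lemma moderate_not_exponential (nu : left_translation G -> R) (H : set G) :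
  moderate_l1 nu -> ~ exponential_growth R H.
Proof.
move=> mod_nu [S [finS S1 _ _] [l l_cvg l_gt1]].
have [sum_nu nu_gt0 _] := mod_nu.
pose lam := (2 + l) / 3; pose mu := (1 + 2 * l) / 3.
have lam_gt1 : 1 < lam by rewrite /lam; lra.
have lammu : lam < mu by rewrite /lam /mu; lra.
have mul : mu < l by rewrite /mu; lra.
have [c c_gt0 cS] := moderate_lower_bound mod_nu finS lam_gt1.
have [M HM] := summable_sum_bound sum_nu nu_gt0.
have card_le n : #|` fset_set (set_power S n)|%:R * c <= lam ^+ n * M.
  have lamn_ge0 : 0 <= lam ^+ n by rewrite exprn_ge0//; lra.
  apply: le_trans (ler_wpM2l lamn_ge0 (HM (fset_set (set_power S n)))).
  rewrite mulr_sumr -sum1_size natr_sum mulr_suml big_seq [leRHS]big_seq.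
  apply: ler_sum => x; rewrite in_fset_set; last exact: finite_set_power.
  by rewrite inE mul1r; exact: cS.
have lam_gt0 : 0 < lam by lra.
have mu_gt0 : 0 < mu by lra.
have M_gt0 : 0 < M.
  have := card_le 0%N; rewrite mul1r; apply: lt_le_trans.
  by rewrite mulr_gt0// ltr0n card_set_power_gt0.
have r_ge0 : 0 <= lam / mu by apply: divr_ge0; exact: ltW.
have r_lt1 : `|lam / mu| < 1.
  by rewrite ger0_norm// ltr_pdivrMr// mul1r.
have cM_gt0 : 0 < c / M by rewrite divr_gt0.
have /cvgrPdist_lt/(_ _ cM_gt0) r_lt := cvg_expr r_lt1.
have lmu_gt0 : 0 < l - mu by lra.
have /cvgrPdist_lt/(_ _ lmu_gt0) root_gt := l_cvg.
near \oo => n.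
have n_gt0 : (0 < n)%N by near: n; exact: nbhs_infty_gt.
have : `|0 - (lam / mu) ^+ n| < c / M by near: n.
have : `|l - #|` fset_set (set_power S n)|%:R `^ n%:R^-1| < l - mu by near: n.
rewrite ltr_distlC => /andP[+ _].
rewrite opprB addrCA subrr addr0 ltNge powR_invn_le ?ler0n ?(ltW mu_gt0)//.
rewrite -ltNge => mu_lt.
rewrite sub0r normrN ger0_norm; last by rewrite exprn_ge0.
rewrite expr_div_n ltr_pdivrMr ?exprn_gt0// mulrAC ltr_pdivlMr// => lt1.
have := card_le n; rewrite leNgt => /negP; apply; apply: lt_trans lt1 _.
by rewrite mulrC ltr_pM2r.
Unshelve. all: by end_near. Qed.

End SubexponentialOfModerate.

Theorem corollary2p3 (R : realType) (G : groupType)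
    (countableG : countable [set: G]) :
  [<-> ~ exists H : set G,
         [/\ subgroup H, finitely_generated H & exponential_growth R H];
       exists nu : left_translation G -> R, moderate_l1 nu;
       forall X : gset G, countable [set: X] ->
         exists nu : X -> R, moderate_l1 nu].
Proof.
have P0P2 X cX := @no_exponential_growth_moderate R G X countableG cX.
have P1P0 : (exists nu : left_translation G -> R, moderate_l1 nu) ->
    ~ exists H : set G,
        [/\ subgroup H, finitely_generated H & exponential_growth R H].
  by move=> [nu mod_nu] [H [_ _]]; exact: (moderate_not_exponential mod_nu).
tfae.
- exact: P0P2.
- by move=> /P1P0 nexp X cX; exact: P0P2.
- by move=> /(_ (left_translation G) countableG); exact: P1P0.
Qed.
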